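(* The following are equivalent for a $T_0$ space $X$. \begin{enumerate} \item The space $X$ is $T_D$. \item The Raney extension $(\Omega(X),\mathcal{U}(X))$ is $\mathcal{E}$-dense. \item The Raney extension $(\Omega(X),\mathcal{U}(X))$ is $\mathcal{E}$-canonical. \item The Raney extension $(\Omega(X),\mathcal{U}(X))$ is isomorphic to $(\Omega(X),\mathsf{Filt}_{\mathcal{E}}(\Omega(X))^{op})$. \item The inclusion $\Omega(X)\subseteq \mathcal{U}(X)$ preserves exact meets. \end{enumerate}
   Context: $\Omega(X)$ is the frame of opens of $X$ and $\mathcal{U}(X)$ the lattice of saturated sets (intersections of open sets). $X$ is $T_D$ if for every $x\in X$ there are opens $U,V$ with $U\setminus V=\{x\}$. A Raney extension is a pair $(L,C)$ where $C$ is a coframe, $L\subseteq C$ is a frame such that every element of $C$ is a meet of elements of $L$, and the inclusion preserves arbitrary joins, finite meets, and strongly exact meets of $L$ (a meet $\bigwedge_i x_i$ in $L$ is strongly exact if for all $y\in L$, $x_i\to y=y$ for all $i$ implies $(\bigwedge_i x_i)\to y=y$). A morphism $f:(L,C)\to(M,D)$ is a coframe map $f:C\to D$ (preserving arbitrary meets and finite joins) with $f[L]\subseteq M$ restricting to a frame map $L\to M$; isomorphisms are taken in this category. A meet $\bigwedge_i x_i$ in a frame $L$ is exact if $(\bigwedge_i x_i)\vee a=\bigwedge_i(x_i\vee a)$ for all $a\in L$. A filter is exact if it is closed under exact meets; $\mathsf{Filt}_{\mathcal{E}}(L)$ is the collection of exact filters ordered by inclusion. The pair $(L,\mathsf{Filt}_{\mathcal{E}}(L)^{op})$,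 with $a\in L$ identified with the principal filter $\uparrow a$, is always a Raney extension. A Raney extension $(L,C)$ is $\mathcal{E}$-dense if each element of $C$ is a join of elements $\bigwedge F$ (meet in $C$) with $F$ an exact filter of $L$; $\mathcal{E}$-compact if for every exact filter $F$ of $L$ and $a\in L$, $\bigwedge F\le a$ implies $a\in F$; $\mathcal{E}$-canonical if it is both $\mathcal{E}$-dense and $\mathcal{E}$-compact. *)

(* Defs.v *)
From HB Require Import structures.
From mathcomp Require Import all_boot all_order.
From mathcomp Require Import boolp classical_sets.
From mathcomp Require Import topology_structure separation_axioms.

Set Implicit Arguments.
Unset Strict Implicit.
Unset Printing Implicit Defensive.

Import Order.TTheory.
Local Open Scope classical_set_scope.

HB.mixin Record isCompleteLattice d T of Order.TBLattice d T := {
  bigjoin : set T -> T;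
  bigmeet : set T -> T;
  bigjoin_leP : forall (A : set T) (x : T), (bigjoin A <= x)%O <-> ubound A x;
  le_bigmeetP : forall (A : set T) (x : T), (x <= bigmeet A)%O <-> lbound A x
}.

#[short(type="completeLatticeType")]
HB.structure Definition CompleteLattice d :=
  {T of Order.TBLattice d T & isCompleteLattice d T}.

HB.mixin Record isFrame d T of CompleteLattice d T := {
  meet_bigjoin : forall (x : T) (A : set T),
    (x `&` bigjoin A)%O = bigjoin [set (x `&` y)%O | y in A]
}.

#[short(type="frameType")]
HB.structure Definition Frame d := {T of CompleteLattice d T & isFrame d T}.

HB.mixin Record isCoframe d T of CompleteLattice d T := {
  join_bigmeet : forall (x : T) (A : set T),
    (x `|` bigmeet A)%O = bigmeet [set (x `|` y)%O | y in A]
}.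

#[short(type="coframeType")]
HB.structure Definition Coframe d := {T of CompleteLattice d T & isCoframe d T}.

Section CompleteLatticeTheory.
Context {d} {T : completeLatticeType d}.
Implicit Types (A : set T) (x y : T).

Lemma bigjoin_ub A x : A x -> (x <= bigjoin A)%O.
Proof. by move=> Ax; apply: (iffLR (bigjoin_leP A _) (lexx _)). Qed.

Lemma bigmeet_lb A x : A x -> (bigmeet A <= x)%O.
Proof. by move=> Ax; apply: (iffLR (le_bigmeetP A _) (lexx _)). Qed.

End CompleteLatticeTheory.

Section Dual.
Context {d : Order.disp_t}.

HB.instance Definition _ (T : completeLatticeType d) :=
  isCompleteLattice.Build (Order.dual_display d) T^d
    (fun A => @le_bigmeetP d T A) (fun A => @bigjoin_leP d T A).

HB.instance Definition _ (T : frameType d) :=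
  isCoframe.Build (Order.dual_display d) T^d (@meet_bigjoin d T).

End Dual.

HB.factory Record POrder_isComplete d T of Order.POrder d T := {
  bigmeet : set T -> T;
  le_bigmeetP : forall (A : set T) (x : T), (x <= bigmeet A)%O <-> lbound A x
}.

HB.builders Context d T of POrder_isComplete d T.

Let bigjoin (A : set T) : T := bigmeet (ubound A).

Let bigjoin_leP A x : (bigjoin A <= x)%O <-> ubound A x.
Proof.
split=> [Ax y Ay|Ax].
  by apply: le_trans Ax; apply/le_bigmeetP => z; apply.
exact: (iffLR (le_bigmeetP (ubound A) _) (lexx _)).
Qed.

Let lexI (x y z : T) :
  (x <= bigmeet [set t | t = y \/ t = z])%O = (x <= y)%O && (x <= z)%O.
Proof.
apply/idP/andP => [/le_bigmeetP h|[xy xz]]; first by split; apply: h; [left|right].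
by apply/le_bigmeetP => t [] ->.
Qed.

Let leUx (x y z : T) :
  (bigjoin [set t | t = x \/ t = y] <= z)%O = (x <= z)%O && (y <= z)%O.
Proof.
apply/idP/andP => [/bigjoin_leP h|[xz yz]]; first by split; apply: h; [left|right].
by apply/bigjoin_leP => t [] ->.
Qed.

HB.instance Definition _ := Order.POrder_MeetJoin_isLattice.Build d T lexI leUx.

Let le0x (x : T) : (bigjoin set0 <= x)%O.
Proof. by apply/bigjoin_leP. Qed.

Let lex1 (x : T) : (x <= bigmeet set0)%O.
Proof. by apply/le_bigmeetP. Qed.

HB.instance Definition _ := Order.hasBottom.Build d T le0x.
HB.instance Definition _ := Order.hasTop.Build d T lex1.
HB.instance Definition _ := isCompleteLattice.Build d T bigjoin_leP le_bigmeetP.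

HB.end.

Section FrameNotions.
Context {d : Order.disp_t} {L : frameType d}.
Implicit Types (A F : set L) (x y : L).

Definition himp x y : L := bigjoin [set z : L | (z `&` x <= y)%O].

(* A family of elements is represented by the set of its members; this loses
   nothing as the notions below do not depend on repetitions. *)
Definition strongly_exact_meet A : Prop :=
  forall y, (forall x, A x -> himp x y = y) -> himp (bigmeet A) y = y.

Definition exact_meet A : Prop :=
  forall a, (bigmeet A `|` a)%O = bigmeet [set (x `|` a)%O | x in A].

(* L itself, i.e. the principal filter of \bot, is a filter. *)
Definition lattice_filter F : Prop :=
  [/\ F \top%O,
      forall x y, F x -> (x <= y)%O -> F y
    & forall x y, F x -> F y -> F (x `&` y)%O].

Definition exact_filter F : Prop :=
  lattice_filter F /\ forall A, A `<=` F -> exact_meet A -> F (bigmeet A).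

End FrameNotions.

Section FrameTheory.
Context {d : Order.disp_t} {L : frameType d}.
Implicit Types (A F : set L) (x y z : L).

Lemma le_himp x y z : (z <= himp x y)%O = (z `&` x <= y)%O.
Proof.
apply/idP/idP => [h|h]; last exact: bigjoin_ub.
apply: (@le_trans _ _ (himp x y `&` x)%O); first exact: leI2.
rewrite meetC meet_bigjoin; apply/bigjoin_leP => _ [w /= wx <-].
by rewrite meetC.
Qed.

Lemma frame_meetUr x y z : (x `&` (y `|` z))%O = ((x `&` y) `|` (x `&` z))%O.
Proof.
apply/le_anti/andP; split; last by rewrite leUx !leI2 ?leUl ?leUr.
by rewrite meetC -le_himp leUx !le_himp ![(_ `&` x)%O]meetC leUl leUr.
Qed.

Lemma frame_le_joinIr x y z :
  ((x `|` z) `&` (y `|` z) <= (x `&` y) `|` z)%O.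
Proof.
rewrite frame_meetUr leUx; apply/andP; split.
  rewrite meetC frame_meetUr leUx; apply/andP; split; first by rewrite meetC leUl.
  exact: le_trans (leIr _ _) (leUr _ _).
exact: le_trans (leIr _ _) (leUr _ _).
Qed.

Lemma strongly_exact_exact A : strongly_exact_meet A -> exact_meet A.
Proof.
move=> sA a; apply/le_anti/andP; split.
  apply/le_bigmeetP => _ [x Ax <-].
  by rewrite leU2 // bigmeet_lb.
set c := bigmeet [set _ | _ in _]; set e := (bigmeet A `|` a)%O.
have E : himp (bigmeet A) (himp c e) = himp c e.
  apply: sA => x Ax; apply/le_anti/andP; split; last first.
    by rewrite le_himp leIl.
  rewrite le_himp; set z := himp x _.
  have cx : (c <= x `|` a)%O by apply: bigmeet_lb; exists x.
  have zx : (z `&` x `&` c <= e)%O by rewrite -!le_himp.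
  rewrite -[X in (z `&` X)%O](meet_l cx) meetA frame_meetUr leUx.
  by rewrite meetAC zx /= (le_trans (leIr _ _)) // leUr.
have : (\top <= himp c e)%O.
  by rewrite -E le_himp meet1x le_himp (le_trans (leIl _ _)) // leUl.
by rewrite le_himp meet1x.
Qed.

Lemma exact_joinr A a : exact_meet A -> exact_meet [set (x `|` a)%O | x in A].
Proof.
move=> eA b; rewrite -eA -joinA eA; congr bigmeet.
apply/seteqP; split => [_ [x Ax <-]|_ [_ [x Ax <-] <-]].
  by exists (x `|` a)%O; [exists x | rewrite joinA].
by exists x => //; rewrite joinA.
Qed.

End FrameTheory.

(* Raney extensions, up to the identification of the subframe L of C with its
   image under an order embedding [incl]. *)
Record raney_extension {d d'} (L : frameType d) (C : coframeType d') :=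
  RaneyExtension {
    incl :> L -> C;
    incl_le : {mono incl : x y / (x <= y)%O};
    incl_bigjoin : forall A : set L, incl (bigjoin A) = bigjoin (incl @` A);
    incl_top : incl \top%O = \top%O;
    incl_meet : {morph incl : x y / (x `&` y)%O};
    incl_strongly_exact : forall A : set L, strongly_exact_meet A ->
      incl (bigmeet A) = bigmeet (incl @` A);
    incl_generates : forall c : C, exists A : set L, c = bigmeet (incl @` A)
  }.

Definition frame_map {d d'} {L : frameType d} {M : frameType d'}
    (g : L -> M) : Prop :=
  [/\ forall A : set L, g (bigjoin A) = bigjoin (g @` A),
      g \top%O = \top%O
    & {morph g : x y / (x `&` y)%O}].

Definition coframe_map {d d'} {C : coframeType d} {D : coframeType d'}
    (f : C -> D) : Prop :=
  [/\ forall A : set C, f (bigmeet A) = bigmeet (f @` A),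
      f \bot%O = \bot%O
    & {morph f : x y / (x `|` y)%O}].

Definition raney_map {d1 d1' d2 d2'}
    {L : frameType d1} {C : coframeType d1'} (R : raney_extension L C)
    {M : frameType d2} {D : coframeType d2'} (S : raney_extension M D)
    (f : C -> D) : Prop :=
  coframe_map f /\
  exists2 g : L -> M, frame_map g & forall a, f (R a) = S (g a).

Definition raney_isomorphic {d1 d1' d2 d2'}
    {L : frameType d1} {C : coframeType d1'} (R : raney_extension L C)
    {M : frameType d2} {D : coframeType d2'} (S : raney_extension M D) : Prop :=
  exists f : C -> D, exists g : D -> C,
    [/\ raney_map R S f, raney_map S R g, cancel f g & cancel g f].

Section RaneyNotions.
Context {d d' : Order.disp_t} {L : frameType d} {C : coframeType d'}.
Variable R : raney_extension L C.

Definition E_dense : Prop :=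
  forall c : C, exists2 S : set (set L), S `<=` exact_filter
    & c = bigjoin [set bigmeet (R @` F) | F in S].

Definition E_compact : Prop :=
  forall F : set L, exact_filter F ->
    forall a : L, (bigmeet (R @` F) <= R a)%O -> F a.

Definition E_canonical : Prop := E_dense /\ E_compact.

Definition preserves_exact_meets : Prop :=
  forall A : set L, exact_meet A -> R (bigmeet A) = bigmeet (R @` A).

End RaneyNotions.

Fact filtE_display : Order.disp_t. Proof. by []. Qed.

Section FiltE.
Context {d : Order.disp_t} (L : frameType d).

Record filtE := FiltE {
  filtE_set :> set L;
  filtE_subproof : `[< exact_filter filtE_set >]
}.

HB.instance Definition _ := [isSub for filtE_set].
HB.instance Definition _ := [Choice of filtE by <:].
HB.instance Definition _ :=
  [SubChoice_isSubPOrder of filtE by <: with filtE_display].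

Lemma filtEP (F : filtE) : exact_filter F.
Proof. by apply/asboolP; case: F. Qed.

Lemma filtE_leP (F G : filtE) : (F <= G)%O <-> filtE_set F `<=` G.
Proof. by rewrite -subsetEset -Order.le_val. Qed.

Lemma filtE_eq (F G : filtE) : filtE_set F = G -> F = G.
Proof. exact: val_inj. Qed.

Lemma filtE_bigcap_exact (P : set filtE) :
  `[< exact_filter (\bigcap_(F in P) (F : set L)) >].
Proof.
apply/asboolP; split; first split.
- by move=> F _; have [[]] := filtEP F.
- by move=> x y Fx xy F PF; have [[_ up _] _] := filtEP F; apply: up xy; apply: Fx.
- move=> x y Fx Fy F PF; have [[_ _ m] _] := filtEP F.
  by apply: m; [apply: Fx|apply: Fy].
- move=> A sA eA F PF; have [_ ex] := filtEP F.
  by apply: ex => // a Aa; apply: sA.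
Qed.

Definition filtE_bigcap (P : set filtE) : filtE :=
  FiltE (filtE_bigcap_exact P).

Lemma le_filtE_bigcap (P : set filtE) (F : filtE) :
  (F <= filtE_bigcap P)%O <-> lbound P F.
Proof.
split=> [/filtE_leP h G PG|h].
  by apply/filtE_leP => x Fx; apply: h.
by apply/filtE_leP => x Fx G PG; apply: (iffLR (filtE_leP _ _) (h _ PG)).
Qed.

HB.instance Definition _ :=
  POrder_isComplete.Build filtE_display filtE le_filtE_bigcap.

Lemma filtE_meetE (F G : filtE) :
  filtE_set (F `&` G)%O = filtE_set F `&` filtE_set G.
Proof.
apply/seteqP; split=> [x|x [Fx Gx]].
  by move=> h; split; apply: h; [left|right].
by move=> H [] ->.
Qed.

Lemma filtE_imp_exact (F G : filtE) :
  `[< exact_filter [set a : L | forall f, filtE_set F f -> filtE_set G (a `|` f)%O] >].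
Proof.
apply/asboolP; have [[G1 up Gm] ex] := filtEP G; split; first split => /=.
- by move=> f _; rewrite join1x.
- by move=> x y h xy f Ff; apply: (up _ _ (h f Ff)); exact: leU2.
- move=> x y hx hy f Ff; apply: (up _ _ (Gm _ _ (hx f Ff) (hy f Ff))).
  exact: frame_le_joinIr.
- move=> A sA eA f Ff; rewrite eA; apply: ex; last exact: exact_joinr.
  by move=> _ [a Aa <-]; apply: sA.
Qed.

Lemma filtE_meet_bigjoin (F : filtE) (P : set filtE) :
  (F `&` bigjoin P)%O = bigjoin [set (F `&` G)%O | G in P].
Proof.
apply/le_anti/andP; split; last first.
  by apply/bigjoin_leP => _ [G PG <-]; apply: leI2 => //; apply: bigjoin_ub.
set J := bigjoin [set _ | _ in _].
have h : (bigjoin P <= FiltE (filtE_imp_exact F J))%O.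
  apply/bigjoin_leP => G PG; apply/filtE_leP => a Ga f Ff.
  have : (F `&` G <= J)%O by apply: bigjoin_ub; exists G.
  move/filtE_leP; apply; rewrite filtE_meetE.
  have [[_ upF _] _] := filtEP F; have [[_ upG _] _] := filtEP G.
  by split; [apply: (upF _ _ Ff); exact: leUr | apply: (upG _ _ Ga); exact: leUl].
apply/filtE_leP => a; rewrite filtE_meetE => -[Fa Pa].
by move/filtE_leP: h => /(_ a Pa a Fa) /=; rewrite joinxx.
Qed.

HB.instance Definition _ :=
  isFrame.Build filtE_display filtE filtE_meet_bigjoin.

Lemma principal_exact (a : L) : `[< exact_filter [set x : L | (a <= x)%O] >].
Proof.
apply/asboolP; split; first split => /=.
- exact: lex1.
- by move=> x y; apply: le_trans.
- by move=> x y ax ay; rewrite lexI ax.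
- by move=> A sA _; apply/le_bigmeetP.
Qed.

Definition principal (a : L) : filtE := FiltE (principal_exact a).

Definition principal_op (a : L) : filtE^d := principal a.

Lemma principal_leP (a : L) (F : filtE) : (principal a <= F)%O <-> filtE_set F a.
Proof.
have [[_ up _] _] := filtEP F; split=> [/filtE_leP|Fa]; first by apply => /=.
by apply/filtE_leP => x /= ax; apply: up ax.
Qed.

Lemma principal_op_le : {mono principal_op : x y / (x <= y)%O}.
Proof.
move=> x y; rewrite leEdual; apply/idP/idP => [/principal_leP //|xy].
exact/principal_leP.
Qed.

Lemma principal_op_bigjoin (A : set L) :
  principal_op (bigjoin A) = bigjoin (principal_op @` A).
Proof.
apply: (@filtE_eq (principal _) (bigmeet (principal @` A))).
apply/seteqP; split=> [x /= /bigjoin_leP Ax _ [a Aa <-]|x h] /=; first exact: Ax.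
by apply/bigjoin_leP => a Aa; apply: (h (principal a)); exists a.
Qed.

Lemma principal_op_exact (A : set L) : exact_meet A ->
  principal_op (bigmeet A) = bigmeet (principal_op @` A).
Proof.
move=> eA; apply/le_anti/andP; split.
  apply/le_bigmeetP => _ [a Aa <-].
  by rewrite principal_op_le; apply: bigmeet_lb.
rewrite leEdual; apply/principal_leP.
have [_ ex] := filtEP (bigjoin (principal @` A) : filtE).
apply: ex eA => a Aa; apply/principal_leP; apply: bigjoin_ub.
by exists a.
Qed.

Lemma principal_op_top : principal_op \top%O = \top%O.
Proof.
apply/le_anti; rewrite lex1 /= leEdual; apply/principal_leP.
by have [[]] := filtEP (\bot%O : filtE).
Qed.

Lemma principal_op_meet : {morph principal_op : x y / (x `&` y)%O}.
Proof.
move=> x y; apply/le_anti/andP; split; first by rewrite lexI !principal_op_le leIl leIr.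
rewrite leEdual; apply/principal_leP.
have [[_ _ m] _] := filtEP (principal x `|` principal y : filtE)%O.
by apply: m; apply/principal_leP; rewrite ?leUl ?leUr.
Qed.

Lemma principal_op_generates (F : filtE^d) :
  exists A : set L, F = bigmeet (principal_op @` A).
Proof.
exists (filtE_set F); apply/le_anti/andP; split.
  by apply/le_bigmeetP => _ [a Fa <-]; rewrite leEdual; apply/principal_leP.
rewrite leEdual; apply/filtE_leP => a Fa.
by apply/principal_leP; apply: bigjoin_ub; exists a.
Qed.

(* (L, Filt_E(L)^op), where a : L is identified with its principal filter. *)
Definition filtE_raney : raney_extension L filtE^d :=
  RaneyExtension principal_op_le principal_op_bigjoin principal_op_top
    principal_op_meet
    (fun A sA => principal_op_exact (strongly_exact_exact sA))
    principal_op_generates.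

End FiltE.

Fact opens_display : Order.disp_t. Proof. by []. Qed.
Fact saturated_display : Order.disp_t. Proof. by []. Qed.

Section Space.
Context (X : topologicalType).

Definition T_D : Prop :=
  forall x : X, exists U V : set X, [/\ open U, open V & U `\` V = [set x]].

Definition saturated (S : set X) : Prop :=
  exists2 P : set (set X), P `<=` open & S = \bigcap_(U in P) U.

Definition openb : {pred set X} := fun U => `[< open U >].
Definition saturatedb : {pred set X} := fun S => `[< saturated S >].

Lemma saturatedP (S : set X) : saturated S <->
  forall x, (forall U, open U -> S `<=` U -> U x) -> S x.
Proof.
split=> [[P Po ->] x h U PU|h].
  by apply: h; [exact: Po|move=> y; apply].
exists [set U | open U /\ S `<=` U]; first by move=> U [].
apply/seteqP; split=> [x Sx U [_]|x hx]; first exact.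
by apply: h => U oU SU; apply: hx.
Qed.

Lemma bigcap_saturated (I : Type) (D : set I) (f : I -> set X) :
  (forall i, D i -> saturated (f i)) -> saturated (\bigcap_(i in D) f i).
Proof.
move=> fs; apply/saturatedP => x h i Di; apply: (iffLR (saturatedP _) (fs i Di)).
by move=> U oU fU; apply: h => // y; move/(_ i Di); exact: fU.
Qed.

Lemma bigcup_saturated (I : Type) (D : set I) (f : I -> set X) :
  (forall i, D i -> saturated (f i)) -> saturated (\bigcup_(i in D) f i).
Proof.
move=> fs; apply/saturatedP => x h; apply: contrapT => nx.
have /choice [W hW] : forall i, exists U, D i -> [/\ open U, f i `<=` U & ~ U x].
  move=> i; have [Di|] := pselect (D i); last by exists setT.
  apply: contrapT => nU; apply: nx; exists i => //.
  apply: (iffLR (saturatedP _) (fs i Di)) => U oU fU.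
  by apply: contrapT => nUx; apply: nU; exists U.
have [||i Di] := h (\bigcup_(i in D) W i).
- by apply: bigcup_open => i /hW [].
- by move=> y [i Di fy]; exists i => //; have [_ fW _] := hW i Di; exact: fW.
- by have [] := hW i Di.
Qed.

Lemma open_saturated (U : set X) : open U -> saturated U.
Proof. by move=> oU; apply/saturatedP => x; apply. Qed.

Lemma openb_meet : Order.ClosedPredicates.meet_closed openb.
Proof. by move=> U V /asboolP oU /asboolP oV; apply/asboolP/openI. Qed.

Lemma openb_join : Order.ClosedPredicates.join_closed openb.
Proof. by move=> U V /asboolP oU /asboolP oV; apply/asboolP/openU. Qed.

Lemma openb_bot : \bot%O \in openb.
Proof. by apply/asboolP/open0. Qed.

Lemma openb_top : \top%O \in openb.
Proof. by apply/asboolP/openT. Qed.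

HB.instance Definition _ := Order.isTBLatticeClosed.Build _ _ openb
  openb_meet openb_join openb_bot openb_top.

Lemma saturatedb_meet : Order.ClosedPredicates.meet_closed saturatedb.
Proof.
move=> S T /asboolP sS /asboolP sT; apply/asboolP.
rewrite meetEset -bigcap2E; apply: bigcap_saturated => -[|[|i]] //= _.
exact/open_saturated/openT.
Qed.

Lemma saturatedb_join : Order.ClosedPredicates.join_closed saturatedb.
Proof.
move=> S T /asboolP sS /asboolP sT; apply/asboolP.
rewrite joinEset -bigcup2E; apply: bigcup_saturated => -[|[|i]] //= _.
exact/open_saturated/open0.
Qed.

Lemma saturatedb_bot : \bot%O \in saturatedb.
Proof. exact/asboolP/open_saturated/open0. Qed.

Lemma saturatedb_top : \top%O \in saturatedb.
Proof. exact/asboolP/open_saturated/openT. Qed.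

HB.instance Definition _ := Order.isTBLatticeClosed.Build _ _ saturatedb
  saturatedb_meet saturatedb_join saturatedb_bot saturatedb_top.

Record opens := Opens { opens_set :> set X; opens_subproof : opens_set \in openb }.

HB.instance Definition _ := [isSub for opens_set].
HB.instance Definition _ := [Choice of opens by <:].
HB.instance Definition _ :=
  [SubChoice_isTBSubLattice of opens by <: with opens_display].

Record saturateds := Saturateds {
  saturateds_set :> set X; saturateds_subproof : saturateds_set \in saturatedb }.

HB.instance Definition _ := [isSub for saturateds_set].
HB.instance Definition _ := [Choice of saturateds by <:].
HB.instance Definition _ :=
  [SubChoice_isTBSubLattice of saturateds by <: with saturated_display].

Lemma opensP (U : opens) : open (U : set X).
Proof. by apply/asboolP; case: U. Qed.

Lemma saturatedsP (S : saturateds) : saturated (S : set X).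
Proof. by apply/asboolP; case: S. Qed.

Lemma opens_leP (U V : opens) : (U <= V)%O <-> opens_set U `<=` V.
Proof. by rewrite -subsetEset -Order.le_val. Qed.

Lemma saturateds_leP (S T : saturateds) :
  (S <= T)%O <-> saturateds_set S `<=` T.
Proof. by rewrite -subsetEset -Order.le_val. Qed.

Definition opens_of (U : set X) (oU : open U) : opens :=
  Opens (introT (asboolP (open U)) oU).

Definition saturateds_of (S : set X) (sS : saturated S) : saturateds :=
  Saturateds (introT (asboolP (saturated S)) sS).

Definition opens_bigcup (A : set opens) : opens :=
  opens_of (bigcup_open (fun U (_ : A U) => opensP U)).

(* Meets of opens are interiors of intersections. *)
Definition opens_bigcap (A : set opens) : opens :=
  opens_of (open_interior (\bigcap_(U in A) (U : set X))).

Definition saturateds_bigcup (A : set saturateds) : saturateds :=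
  saturateds_of (bigcup_saturated (fun S (_ : A S) => saturatedsP S)).

Definition saturateds_bigcap (A : set saturateds) : saturateds :=
  saturateds_of (bigcap_saturated (fun S (_ : A S) => saturatedsP S)).

Lemma opens_bigcup_leP (A : set opens) (V : opens) :
  (opens_bigcup A <= V)%O <-> ubound A V.
Proof.
split=> [/opens_leP h U AU|h].
  by apply/opens_leP => x Ux; apply: h; exists U.
by apply/opens_leP => x [U AU Ux]; move/opens_leP: (h U AU); apply.
Qed.

Lemma le_opens_bigcapP (A : set opens) (V : opens) :
  (V <= opens_bigcap A)%O <-> lbound A V.
Proof.
split=> [/opens_leP h U AU|h].
  by apply/opens_leP => x Vx; apply: (interior_subset (h x Vx)).
apply/opens_leP; rewrite -open_subsetE; last exact: opensP.
by move=> x Vx U AU; move/opens_leP: (h U AU); apply.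
Qed.

Lemma saturateds_bigcup_leP (A : set saturateds) (T : saturateds) :
  (saturateds_bigcup A <= T)%O <-> ubound A T.
Proof.
split=> [/saturateds_leP h S AS|h].
  by apply/saturateds_leP => x Sx; apply: h; exists S.
by apply/saturateds_leP => x [S AS Sx]; move/saturateds_leP: (h S AS); apply.
Qed.

Lemma le_saturateds_bigcapP (A : set saturateds) (T : saturateds) :
  (T <= saturateds_bigcap A)%O <-> lbound A T.
Proof.
split=> [/saturateds_leP h S AS|h].
  by apply/saturateds_leP => x Tx; apply: h.
by apply/saturateds_leP => x Tx S AS; move/saturateds_leP: (h S AS); apply.
Qed.

HB.instance Definition _ := isCompleteLattice.Build opens_display opens
  opens_bigcup_leP le_opens_bigcapP.

HB.instance Definition _ := isCompleteLattice.Build saturated_display saturateds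
  saturateds_bigcup_leP le_saturateds_bigcapP.

Lemma opens_meet_bigjoin (U : opens) (A : set opens) :
  (U `&` bigjoin A)%O = bigjoin [set (U `&` V)%O | V in A].
Proof.
apply: val_inj; apply/seteqP; split=> [x [Ux [V AV Vx]]|x [_ [V AV <-] [Ux Vx]]].
  by exists (U `&` V)%O; [exists V|].
by split=> //; exists V.
Qed.

HB.instance Definition _ := isFrame.Build opens_display opens opens_meet_bigjoin.

Lemma saturateds_join_bigmeet (S : saturateds) (A : set saturateds) :
  (S `|` bigmeet A)%O = bigmeet [set (S `|` T)%O | T in A].
Proof.
apply: val_inj; apply/seteqP; split=> [x [Sx|Ax] _ [T AT <-]|x h].
- by left.
- by right; apply: Ax.
- have [Sx|nSx] := pselect (saturateds_set S x); first by left.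
  by right=> T AT; case: (h (S `|` T)%O); first exists T.
Qed.

HB.instance Definition _ :=
  isCoframe.Build saturated_display saturateds saturateds_join_bigmeet.

Definition opens_incl (U : opens) : saturateds :=
  saturateds_of (open_saturated (opensP U)).

Lemma opens_incl_le : {mono opens_incl : U V / (U <= V)%O}.
Proof. by []. Qed.

Lemma opens_incl_bigjoin (A : set opens) :
  opens_incl (bigjoin A) = bigjoin (opens_incl @` A).
Proof.
apply: val_inj; apply/seteqP; split=> [x [U AU Ux]|x [_ [U AU <-] Ux]].
  by exists (opens_incl U) => //; exists U.
by exists U.
Qed.

Lemma opens_incl_top : opens_incl \top%O = \top%O.
Proof. exact: val_inj. Qed.

Lemma opens_incl_meet : {morph opens_incl : U V / (U `&` V)%O}.
Proof. by move=> U V; apply: val_inj. Qed.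

Lemma opens_incl_strongly_exact (A : set opens) : strongly_exact_meet A ->
  opens_incl (bigmeet A) = bigmeet (opens_incl @` A).
Proof.
move=> sA; apply: val_inj; apply/seteqP; split=> [x hx _ [U AU <-]|x hx].
  exact: (interior_subset hx).
pose p : opens := opens_bigcup [set V : opens | ~ (V : set X) x].
have pP (V : opens) : (V <= p)%O <-> ~ (V : set X) x.
  split=> [/opens_leP Vp Vx|nVx]; first by have [W] := Vp x Vx.
  by apply/opens_leP => y Vy; exists V.
have himpp (U : opens) : (U : set X) x -> himp U p = p.
  move=> Ux; apply/le_anti/andP; split; last by rewrite le_himp leIl.
  apply/pP => hUx; have : (himp U p `&` U <= p)%O by rewrite -le_himp.
  by move/pP; apply; split.
have /sA E : forall U, A U -> himp U p = p.
  by move=> U AU; apply: himpp; apply: (hx (opens_incl U)); exists U.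
apply: contrapT => /(iffRL (pP (bigmeet A))) Ap.
have : (\top <= p)%O by rewrite -E le_himp meet1x.
by move/pP; apply.
Qed.

Lemma opens_incl_generates (S : saturateds) :
  exists A : set opens, S = bigmeet (opens_incl @` A).
Proof.
have [P Po SE] := saturatedsP S.
exists [set U : opens | P U]; apply: val_inj; rewrite /= SE.
apply/seteqP; split=> [x Px _ [U PU <-]|x h U PU]; first exact: Px.
by apply: (h (opens_incl (opens_of (Po _ PU)))); exists (opens_of (Po _ PU)).
Qed.

(* (Omega(X), U(X)) *)
Definition space_raney : raney_extension opens saturateds :=
  RaneyExtension opens_incl_le opens_incl_bigjoin opens_incl_top
    opens_incl_meet opens_incl_strongly_exact opens_incl_generates.

End Space.

(* Main.v *)
Require Import Defs.
From mathcomp Require Import all_boot all_order.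
From mathcomp Require Import boolp classical_sets.
From mathcomp Require Import topology_structure separation_axioms.

(** Two facts hold for every Raney extension [(L, C)].  It is automatically
    E-compact: a meet of [L] that [C] computes in the same way is exact, by
    coframe distributivity in [C] ([exact_meet_of_preserved]), and if
    [bigmeet F <= a] in [C] then the elements [w `|` a], for [w] in [F], form
    such a meet with value [a]; closure of [F] under exact meets gives [F a]
    ([raney_E_compact]).  So E-dense and E-canonical coincide, and then
    [c |-> {a | c <= a}] and [F |-> bigmeet F] are mutually inverse between
    [C] and the exact filters with reversed order
    ([E_canonical_isomorphic]).  Since principal filters turn exact meets into
    meets, and this property is invariant under isomorphism
    ([preserves_exact_meets_isomorphic]), an E-canonical extension preserves
    exact meets.

    What remains concerns a point [x] of a space.  If [{x}] is [U] minus [V],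
    joining with [V] shows that the open neighbourhoods of [x] form an exact
    filter; as a saturated set is the union of the saturations of its points,
    density follows ([E_dense_of_T_D]).  Conversely, let [p] be the largest open
    set that misses [x].  The open sets that contain [p] and [x] always have an
    exact meet, and in a T0 space they intersect in [p] together with [x].  If
    exact meets are intersections, this set is open, and removing [p] leaves
    [{x}] ([T_D_of_preserves_exact_meets]). *)

Set Implicit Arguments.
Unset Strict Implicit.
Unset Printing Implicit Defensive.

Import Order.TTheory.
Local Open Scope classical_set_scope.

(** * Order isomorphisms of complete lattices *)

Section OrderIso.
Context {d d' : Order.disp_t}.
Context {T : completeLatticeType d} {T' : completeLatticeType d'}.
Variables (f : T -> T') (g : T' -> T).
Hypotheses (f_le : {mono f : x y / (x <= y)%O}) (gK : cancel g f).

Lemma iso_bigmeet (A : set T) : f (bigmeet A) = bigmeet (f @` A).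
Proof.
apply/le_anti/andP; split.
  by apply/le_bigmeetP => _ [a Aa <-]; rewrite f_le bigmeet_lb.
rewrite -[leLHS]gK f_le; apply/le_bigmeetP => a Aa.
by rewrite -f_le gK bigmeet_lb //; exists a.
Qed.

Lemma iso_bot : f \bot%O = \bot%O.
Proof. by apply/le_anti; rewrite le0x -[leRHS]gK f_le le0x. Qed.

Lemma iso_join : {morph f : x y / (x `|` y)%O}.
Proof.
move=> x y; apply/le_anti/andP; split; last by rewrite leUx !f_le leUl leUr.
by rewrite -[leRHS]gK f_le leUx -2!f_le !gK leUl leUr.
Qed.

End OrderIso.

Lemma iso_coframe_map {d d'} {C : coframeType d} {D : coframeType d'}
    (f : C -> D) (g : D -> C) :
  {mono f : x y / (x <= y)%O} -> cancel g f -> coframe_map f.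
Proof.
move=> f_le gK.
by split; [exact: iso_bigmeet gK|exact: iso_bot gK|exact: iso_join gK].
Qed.

Section FrameIso.
Context {d d' : Order.disp_t} {L : frameType d} {M : frameType d'}.
Variables (f : L -> M) (g : M -> L).
Hypotheses (f_le : {mono f : x y / (x <= y)%O}) (gK : cancel g f).

Lemma iso_exact_meet (A : set L) : exact_meet A -> exact_meet (f @` A).
Proof.
move=> eA b; rewrite -[in LHS](gK b) -(iso_bigmeet f_le gK).
rewrite -(iso_join f_le gK) eA (iso_bigmeet f_le gK); congr bigmeet.
apply/seteqP; split=> [_ [_ [a Aa <-] <-]|_ [_ [a Aa <-] <-]].
  by exists (f a); [exists a|rewrite (iso_join f_le gK) gK].
by exists (a `|` g b)%O; [exists a|rewrite (iso_join f_le gK) gK].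
Qed.

End FrameIso.

Lemma frame_map_id {d} {L : frameType d} : frame_map (@id L).
Proof. by split=> // A; rewrite image_id. Qed.

Lemma coframe_map_le {d d'} {C : coframeType d} {D : coframeType d'}
    (f : C -> D) : coframe_map f -> {homo f : x y / (x <= y)%O}.
Proof. by case=> _ _ fU x y /join_r <-; rewrite fU leUl. Qed.

(** * Raney extensions *)

Section Raney.
Context {d d' : Order.disp_t} {L : frameType d} {C : coframeType d'}.
Variable R : raney_extension L C.

Lemma incl_join : {morph R : x y / (x `|` y)%O}.
Proof.
move=> x y; have -> : (x `|` y)%O = bigjoin [set x; y].
  apply/le_anti; rewrite leUx !bigjoin_ub /=; [|by right|by left].
  by apply/bigjoin_leP => z [] ->; rewrite ?leUl ?leUr.
rewrite incl_bigjoin; apply/le_anti/andP; split.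
  by apply/bigjoin_leP => _ [z [] -> <-]; rewrite ?leUl ?leUr.
by rewrite leUx !bigjoin_ub //; [exists y => //; right|exists x => //; left].
Qed.

Lemma bigmeet_incl_join (A : set L) (a : L) :
  bigmeet (R @` [set (x `|` a)%O | x in A]) = (bigmeet (R @` A) `|` R a)%O.
Proof.
rewrite joinC join_bigmeet; congr bigmeet.
apply/seteqP; split=> [_ [_ [x Ax <-] <-]|_ [_ [x Ax <-] <-]].
  by exists (R x); [exists x|rewrite incl_join joinC].
by exists (x `|` a)%O; [exists x|rewrite incl_join joinC].
Qed.

Lemma incl_bigmeet_le (A : set L) : (R (bigmeet A) <= bigmeet (R @` A))%O.
Proof. by apply/le_bigmeetP => _ [x Ax <-]; rewrite incl_le bigmeet_lb. Qed.

(** The distributivity that exactness asks for in [L] is inherited from the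
    coframe [C] as soon as [C] computes the meet in question. *)
Lemma exact_meet_of_preserved (A : set L) :
  R (bigmeet A) = bigmeet (R @` A) -> exact_meet A.
Proof.
move=> RA a; apply/le_anti/andP; split.
  by apply/le_bigmeetP => _ [x Ax <-]; rewrite leU2 // bigmeet_lb.
by rewrite -(incl_le R) incl_join RA -bigmeet_incl_join incl_bigmeet_le.
Qed.

(** If [bigmeet F <= a] in [C], then by distributivity [a] is the meet in [C],
    hence in [L], of the joins [w `|` a] with [w] in [F]. *)
Lemma raney_E_compact : E_compact R.
Proof.
move=> F [[_ up _] Fex] a Fa.
pose A := [set (w `|` a)%O | w in F].
have RA : bigmeet (R @` A) = R a by rewrite bigmeet_incl_join; exact: join_r.
have aE : bigmeet A = a.
  apply/le_anti/andP; split; first by rewrite -(incl_le R) -RA incl_bigmeet_le.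
  by apply/le_bigmeetP => _ [w _ <-]; exact: leUr.
rewrite -aE; apply: Fex; last by apply: exact_meet_of_preserved; rewrite RA aE.
by move=> _ [w Fw <-]; apply: up Fw _; exact: leUl.
Qed.

Definition above (c : C) : set L := [set a | (c <= R a)%O].

Lemma bigmeet_above (c : C) : bigmeet (R @` above c) = c.
Proof.
apply/le_anti/andP; split; last by apply/le_bigmeetP => _ [a ca <-].
have [A ->] := incl_generates R c.
apply/le_bigmeetP => _ [a Aa <-]; apply: bigmeet_lb; exists a => //.
by apply: bigmeet_lb; exists a.
Qed.

Lemma above_bigmeet (F : set L) :
  E_compact R -> exact_filter F -> above (bigmeet (R @` F)) = F.
Proof.
move=> cpt eF; apply/seteqP; split=> [a|a Fa]; first exact: cpt.
by apply: bigmeet_lb; exists a.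
Qed.

(** By density [c] is the join of some [bigmeet F] with [F] exact, so by
    compactness [above c] is the intersection of these [F]. *)
Lemma above_exact (c : C) : E_canonical R -> exact_filter (above c).
Proof.
move=> [/(_ c) [S Sex cE] cpt].
suff -> : above c = filtE_bigcap [set F : filtE L | S F] by exact: filtEP.
apply/seteqP; split=> [a ca F SF|a Sa].
  apply: (cpt _ (Sex _ SF)); apply: le_trans ca.
  by rewrite cE; apply: bigjoin_ub; exists F.
rewrite /above /= cE; apply/bigjoin_leP => _ [F SF <-].
apply: bigmeet_lb; exists a => //.
by apply: (Sa (FiltE (introT (asboolP _) (Sex _ SF)))).
Qed.

Lemma E_canonical_isomorphic : E_canonical R ->
  raney_isomorphic R (filtE_raney L).
Proof.
move=> can.
pose f (c : C) : (filtE L)^d :=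
  FiltE (introT (asboolP _) (above_exact c can)) : filtE L.
pose g (F : (filtE L)^d) : C := bigmeet (R @` filtE_set (F : filtE L)).
have fK : cancel f g by move=> c; exact: bigmeet_above.
have gK : cancel g f.
  move=> F; apply: (@filtE_eq _ L).
  by apply: above_bigmeet; [exact: can.2|exact: filtEP].
have f_le : {mono f : x y / (x <= y)%O}.
  move=> c e; rewrite leEdual; apply/idP/idP => [/filtE_leP h|ce].
    rewrite -(bigmeet_above c) -(bigmeet_above e).
    by apply/le_bigmeetP => _ [a ea <-]; apply: bigmeet_lb; exists a => //; exact: h.
  by apply/filtE_leP => a /= ea; apply: le_trans ce ea.
have g_le : {mono g : x y / (x <= y)%O} by move=> F G; rewrite -f_le !gK.
have fR a : f (R a) = principal_op a.
  apply: (@filtE_eq _ L).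
  by apply/seteqP; split=> b; rewrite /= /above /= incl_le.
exists f, g; split=> //.
- split; first exact: iso_coframe_map gK.
  by exists id => //; exact: frame_map_id.
- split; first exact: iso_coframe_map fK.
  by exists id; [exact: frame_map_id|move=> a; rewrite -[RHS]fK fR].
Qed.

End Raney.

Section Invariance.
Context {d1 d1' d2 d2' : Order.disp_t}.
Context {L : frameType d1} {C : coframeType d1'} (R : raney_extension L C).
Context {M : frameType d2} {D : coframeType d2'} (S : raney_extension M D).

(** An isomorphism restricts to an order isomorphism of the frames, which
    transports exact meets. *)
Lemma preserves_exact_meets_isomorphic :
  raney_isomorphic R S -> preserves_exact_meets S -> preserves_exact_meets R.
Proof.
case=> f [g [[f_map [u _ fR]] [g_map [v _ gS]] fK gK]] pS A eA.
have f_le : {mono f : x y / (x <= y)%O}.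
  move=> x y; apply/idP/idP; last exact: coframe_map_le.
  by move/(coframe_map_le g_map); rewrite !fK.
have u_le : {mono u : x y / (x <= y)%O}.
  by move=> x y; rewrite -(incl_le S) -!fR f_le incl_le.
have vK : cancel v u.
  by move=> b; apply: (inc_inj (incl_le S)); rewrite -fR -gS gK.
rewrite -[LHS]fK fR (iso_bigmeet u_le vK) pS; last exact: iso_exact_meet vK _ eA.
have [gI _ _] := g_map; rewrite gI; congr bigmeet.
apply/seteqP; split=> [_ [_ [_ [a Aa <-] <-] <-]|_ [a Aa <-]].
  by exists a => //; rewrite -fR fK.
exists (S (u a)); last by rewrite -fR fK.
by exists (u a) => //; exists a.
Qed.

End Invariance.

(** * Points of a space *)

Section Points.
Context (X : topologicalType).

Definition open_nbhs_of (x : X) : set (opens X) := [set U | opens_set U x].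

Definition avoid (x : X) : opens X :=
  opens_bigcup [set V : opens X | ~ opens_set V x].

Lemma le_avoid (x : X) (V : opens X) : (V <= avoid x)%O <-> ~ opens_set V x.
Proof.
split=> [/opens_leP Vp Vx|nVx]; first by have [W] := Vp x Vx.
by apply/opens_leP => y Vy; exists V.
Qed.

(** Let [{x}] be [U] minus [V].  If all members of an exact family contain
    [x], their joins with [V] contain [U]; hence so does the join of the meet
    with [V], and [x] is not in [V]. *)
Lemma open_nbhs_exact (x : X) : T_D X -> exact_filter (open_nbhs_of x).
Proof.
move=> /(_ x) [U [V [oU oV UVx]]].
have [Ux nVx] : (U `\` V) x by rewrite UVx.
split; first split=> //.
- by move=> W Z Wx /opens_leP; apply.
- move=> A Ax eA.
  have : (opens_of oU <= bigmeet A `|` opens_of oV)%O.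
    rewrite eA; apply/le_bigmeetP => _ [W AW <-]; apply/opens_leP => y Uy.
    have [Vy|nVy] := pselect (V y); first by right.
    have -> : y = x by have : (U `\` V) y by []; rewrite UVx.
    by left; exact: Ax.
  by move/opens_leP/(_ x Ux) => [].
Qed.

Lemma E_dense_of_T_D : T_D X -> E_dense (space_raney X).
Proof.
move=> TD c; exists [set open_nbhs_of x | x in saturateds_set c].
  by move=> _ [x _ <-]; exact: open_nbhs_exact.
apply/le_anti/andP; split; apply/saturateds_leP.
  move=> x cx; exists (bigmeet (space_raney X @` open_nbhs_of x)).
    by exists (open_nbhs_of x) => //; exists x.
  by move=> _ [U Ux <-].
move=> y [_ [_ [x cx <-] <-] hy].
apply: (iffLR (saturatedP _) (saturatedsP c)) => U oU cU.
apply: (hy (opens_incl (opens_of oU))).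
by exists (opens_of oU) => //; exact: cU.
Qed.

(** When joining with [a], either [a] contains [x], and then [avoid x `|` a] is
    itself a member of the family, or [a] is below every member. *)
Lemma exact_meet_avoid (x : X) :
  exact_meet [set U | (avoid x <= U)%O /\ opens_set U x].
Proof.
move=> a; set A := [set U | _]; have pA : (avoid x <= bigmeet A)%O.
  by apply/le_bigmeetP => U [].
apply/le_anti/andP; split.
  by apply/le_bigmeetP => _ [U AU <-]; rewrite leU2 // bigmeet_lb.
have [ax|/le_avoid ap] := pselect (opens_set a x).
  apply: (@le_trans _ _ (avoid x `|` a)%O); last exact: leU2.
  apply: bigmeet_lb; exists (avoid x `|` a)%O; last by rewrite -joinA joinxx.
  by split; [exact: leUl|right].
apply: le_trans (leUl _ _); apply/le_bigmeetP => U AU.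
apply: bigmeet_lb; exists U => //; apply: join_l.
by apply: le_trans ap _; case: AU.
Qed.

Lemma T_D_of_preserves_exact_meets : kolmogorov_space X ->
  preserves_exact_meets (space_raney X) -> T_D X.
Proof.
move=> T0 pres x; pose A := [set U : opens X | (avoid x <= U)%O /\ opens_set U x].
have AE : opens_incl (bigmeet A) = bigmeet (@opens_incl X @` A).
  exact/pres/exact_meet_avoid.
exists (opens_set (bigmeet A)), (opens_set (avoid x)).
split; [exact: opensP|exact: opensP|].
apply/seteqP; split=> [y [Ay npy]|_ ->].
  apply: contrapT => /eqP yx; have [B [[By nBx]|[Bx nBy]]] := T0 _ _ yx.
    (* An open neighbourhood of y without x lies below avoid x. *)
    apply: npy; exists (opens_of (open_interior B)).
      by move=> /interior_subset; move: nBx; rewrite inE.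
    by move: By; rewrite inE.
  (* An open neighbourhood of x without y, joined with avoid x, is in A. *)
  pose W := (opens_of (open_interior B) `|` avoid x)%O.
  have AW : A W by split; [exact: leUr|left; move: Bx; rewrite inE].
  have /opens_leP/(_ y Ay) : (bigmeet A <= W)%O by exact: bigmeet_lb.
  case=> [/interior_subset|//].
  by move: nBy; rewrite inE.
split; last exact: (iffLR (le_avoid x _) (lexx _)).
suff : saturateds_set (opens_incl (bigmeet A)) x by [].
by rewrite AE => _ [U [_ Ux] <-].
Qed.

End Points.

Theorem theorem4p6 (X : topologicalType) (X_T0 : kolmogorov_space X) :
  [<-> T_D X;
       E_dense (space_raney X);
       E_canonical (space_raney X);
       raney_isomorphic (space_raney X) (filtE_raney (opens X));
       preserves_exact_meets (space_raney X)].
Proof.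
tfae.
- exact: E_dense_of_T_D.
- by move=> dense; split=> //; exact: raney_E_compact.
- exact: E_canonical_isomorphic.
- move/preserves_exact_meets_isomorphic; apply=> A eA.
  exact: principal_op_exact.
- exact: T_D_of_preserves_exact_meets.
Qed.
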